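(* Let $X=\mathbf P^1\setminus\{0,1,\infty\}$, let $z\in X(\mathbf C)$ and let $b_z\in\pi_1^{\mathrm{top}}(X(\mathbf C):\overrightarrow{01},z)$ be a topological path, regarded as a de Rham path over $\mathbf C$ via the Hodge comparison isomorphism. Let $d_z$ be the canonical de Rham path from $\overrightarrow{01}$ to $z$. Then the de Rham loop $d_z^{-1}b_z\in\pi_1^{\mathrm{DR}}(X:\overrightarrow{01})(\mathbf C)$ corresponds, under the embedding $i$, to the special value at $z$ of the analytic continuation along $b_z$ of the fundamental solution $G_0$ of the KZ equation: $$i(d_z^{-1}b_z)=G_0(z)\in\mathbf C\langle\langle A,B\rangle\rangle.$$
   Context: **De Rham side.** $X=\mathbf P^1\setminus\{0,1,\infty\}$ with coordinate $t$, $\overline X=\mathbf P^1$, $D=\{0,1,\infty\}$. For a field $K$ of characteristic $0$, $\mathcal{NC}^{\mathrm{DR}}(X_K)$ is the tannakian category of unipotent (iterated extensions of the unit object) bundles with integrable connection on $X_K$. The canonical (log, nilpotent residue) extension to $\overline X$ of such an object has trivial underlying bundle; with $V$ its space of global sections the object is $(V\otimes\mathcal O_X,\,d+\omega)$, $\omega\in H^0(\overline X,\Omega^1(\log D))\otimes \mathrm{End}\,V$. Fiber functors: $\omega_\Gamma$ (value $V$); $\omega_x$ (fiber at $x\in X(K)$); for $s\in D$ and a $K$-point $t_s$ of $T_s^\times=T_s\overline X\setminus\{0\}$, $\omega_{t_s}$ = fiber at $t_s$ of $(V\otimes\mathcal O_{T_s^\times},\,d+\mathrm{Res}_s(\omega)\frac{dt_s}{t_s})$.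 $\overrightarrow{01}$ is the point $t_0=1$ of $T_0^\times$ ($t_0$ induced by $t$), $\overrightarrow{10}$ the point $t_1=1$ of $T_1^\times$ ($t_1$ induced by $1-t$). $\pi_1^{\mathrm{DR}}(X_K:*,*')=\underline{\mathrm{Isom}}^\otimes(\omega_*,\omega_{*'})$; $\gamma'\gamma$ means first $\gamma$, then $\gamma'$. All these functors are canonically isomorphic to $\omega_\Gamma$, giving canonical paths $d_{*,*'}$; $d_z=d_{\overrightarrow{01},z}$, $d=d_{\overrightarrow{01},\overrightarrow{10}}$. Let $x\in\pi_1^{\mathrm{DR}}(X:\overrightarrow{01})$ be the image of the exponential of the dual of $\frac{dt_0}{t_0}$ in $\pi_1^{\mathrm{DR}}(T_0^\times:\overrightarrow{01})$, $y'\in\pi_1^{\mathrm{DR}}(X:\overrightarrow{10})$ similarly for $\frac{dt_1}{t_1}$ on $T_1^\times$, $y=d^{-1}y'd$ (on $V$, $x$ acts by $\exp(-\mathrm{Res}_0\omega)$, $y'$ by $\exp(-\mathrm{Res}_1\omega)$). $i:\pi_1^{\mathrm{DR}}(X:\overrightarrow{01})(K)\hookrightarrow K\langle\langle A,B\rangle\rangle$ is the embedding with $x\mapsto e^A$, $y\mapsto e^B$. **Betti side.** $\pi_1^{\mathrm{Be}}(X(\mathbf C):*,*')$ is $\underline{\mathrm{Isom}}^\otimes(\omega_*,\omega_{*'})$ for the category of unipotent local systems of finite dimensional $\mathbf Q$-vector spaces on $X(\mathbf C)$ (fibers at points, or at tangential base points); topological paths give $\mathbf Q$-points of it. The equivalence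 of unipotent connections on $X_{\mathbf C}$ with unipotent $\mathbf C$-local systems (horizontal sections) gives the Hodge comparison isomorphism $\pi_1^{\mathrm{DR}}(X:\overrightarrow{01},z)\times\mathbf C\cong\pi_1^{\mathrm{Be}}(X(\mathbf C):\overrightarrow{01},z)\times\mathbf C$; concretely, at $\overrightarrow{01}$ a horizontal section near $0$, written as $P(t)\,t^{-\mathrm{Res}_0\omega}v$ with $P$ holomorphic and $P(0)=1$, corresponds to the vector $v$. **KZ.** $G_0$ is the fundamental solution of $\frac{dG}{dz}=\left(\frac Az+\frac B{z-1}\right)G$ in $\mathbf C\langle\langle A,B\rangle\rangle$-valued (multi-valued) analytic functions with $G_0(z)\approx z^A$ as $z\to0$ (i.e. $G_0(z)=P(z)\exp(A\log z)$ with $P$ holomorphic at $0$, $P(0)=1$), with the principal branch of $\log$ for $z\in(0,1)$. *)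

(* Defs.v *)
From HB Require Import structures.
From mathcomp Require Import all_boot all_order all_algebra.
From mathcomp Require Import all_classical all_reals all_analysis.
From mathcomp Require Import complex mxtens.

Set Implicit Arguments.
Unset Strict Implicit.
Unset Printing Implicit Defensive.

Import Order.TTheory GRing.Theory Num.Theory.
Import numFieldNormedType.Exports.

Local Open Scope classical_set_scope.
Local Open Scope ring_scope.

(* R[i] seen as a numClosedFieldType, so that the normed-module structure that
   a numFieldType has over itself (hence complex differentiability) applies. *)
Definition CC (R : realType) : numClosedFieldType := R[i].

Lemma sum_triangle (V : nmodType) (N : nat) (F : nat -> nat -> V) :
  \sum_(k < N) \sum_(i < k.+1) F i (k - i)%N =
  \sum_(i < N) \sum_(j < (N - i)%N) F i j.
Proof.
elim: N => [|N IH]; first by rewrite !big_ord0.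
rewrite big_ord_recr /= IH [RHS]big_ord_recr /= subSnn big_ord1.
rewrite [X in _ + X]big_ord_recr /= subnn addrA; congr (_ + _).
rewrite -big_split /=; apply: eq_bigr => i _.
by rewrite subSn ?(ltnW (ltn_ord i)) // big_ord_recr.
Qed.

(* C<<A,B>>: a series is its family of coefficients, indexed by words in two
   letters, [false] standing for A and [true] for B.                         *)
Section Series.
Variable R : realType.
Local Notation C := (CC R).

Definition ncseries : Type := seq bool -> C.

HB.instance Definition _ := GRing.Lmodule.copy ncseries (seq bool -> C).

Definition ser_one : ncseries := fun w => (w == [::])%:R.

Definition ser_mul (f g : ncseries) : ncseries :=
  fun w => \sum_(k < (size w).+1) f (take k w) * g (drop k w).

Lemma ser_mulA : associative ser_mul.
Proof.
move=> f g h; apply/funext => w; rewrite /ser_mul.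
pose F i j := f (take i w) * g (take j (drop i w)) * h (drop (i + j) w).
transitivity (\sum_(i < (size w).+1) \sum_(j < ((size w).+1 - i)%N) F i j).
  apply: eq_bigr => i _; rewrite mulr_sumr size_drop subSn -1?ltnS //.
  by apply: eq_bigr => j _; rewrite mulrA drop_drop addnC.
rewrite -sum_triangle; apply: eq_bigr => k _; rewrite mulr_suml.
have lek : (k <= size w)%N by rewrite -ltnS.
rewrite size_takel //; apply: eq_bigr => j _; rewrite /F.
have jk : (j <= k)%N by rewrite -ltnS.
by rewrite subnKC // take_takel // take_drop subnK // drop_take.
Qed.

Lemma ser_mul1s : left_id ser_one ser_mul.
Proof.
move=> f; apply/funext => w; rewrite /ser_mul big_ord_recl /= take0 drop0 mul1r.
rewrite big1 ?addr0 // => i _; rewrite /ser_one.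
by case: w i => [[]//|a w i] /=; rewrite mul0r.
Qed.

Lemma ser_muls1 : right_id ser_one ser_mul.
Proof.
move=> f; apply/funext => w; rewrite /ser_mul big_ord_recr /=.
rewrite take_size drop_size mulr1.
rewrite big1 ?add0r // => i _; rewrite /ser_one.
by rewrite -size_eq0 size_drop subn_eq0 leqNgt ltn_ord mulr0.
Qed.

Lemma ser_mulDl : left_distributive ser_mul +%R.
Proof.
move=> f g h; apply/funext => w.
rewrite -[RHS]/(ser_mul f h w + ser_mul g h w) /ser_mul -big_split.
by apply: eq_bigr => i _; exact: mulrDl.
Qed.

Lemma ser_mulDr : right_distributive ser_mul +%R.
Proof.
move=> f g h; apply/funext => w.
rewrite -[RHS]/(ser_mul f g w + ser_mul f h w) /ser_mul -big_split.
by apply: eq_bigr => i _; exact: mulrDr.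
Qed.

Lemma ser_1neq0 : ser_one != 0.
Proof. by apply/eqP => /(congr1 (@^~ [::])) /eqP; rewrite oner_eq0. Qed.

HB.instance Definition _ := GRing.Zmodule_isNzRing.Build ncseries
  ser_mulA ser_mul1s ser_muls1 ser_mulDl ser_mulDr ser_1neq0.

Definition serA : ncseries := fun w => (w == [:: false])%:R.
Definition serB : ncseries := fun w => (w == [:: true])%:R.

(* Exponential of a series S without constant term; S ^+ k has no words of
   length < k, so each coefficient is a finite sum. *)
Definition ser_exp (S : ncseries) : ncseries :=
  fun w => \sum_(k < (size w).+1) k`!%:R^-1 * (S ^+ k) w.

End Series.
Arguments serA {R}.
Arguments serB {R}.

(* Exponential of a nilpotent matrix M of size n: M ^+ n = 0. *)
Section NilExp.
Variable R : realType.
Local Notation C := (CC R).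

Definition nilexp n (M : 'M[C]_n) : 'M[C]_n := \sum_(k < n) k`!%:R^-1 *: M ^+ k.

Lemma mulrmxE n (A B : 'M[C]_n) : A * B = A *m B.
Proof. by []. Qed.

Definition truncexp n N (M : 'M[C]_n) : 'M[C]_n :=
  \sum_(k < N) k`!%:R^-1 *: M ^+ k.

Lemma nilpotent_le n (M : 'M[C]_n) m k : M ^+ m = 0 -> (m <= k)%N -> M ^+ k = 0.
Proof. by move=> M0 /subnKC <-; rewrite exprD M0 mul0r. Qed.

Lemma truncexp_widen n (M : 'M[C]_n) m N : M ^+ m = 0 -> (m <= N)%N ->
  truncexp N M = truncexp m M.
Proof.
move=> M0 mN; rewrite /truncexp (big_ord_widen _ (fun k => k`!%:R^-1 *: M ^+ k) mN).
rewrite [LHS](bigID (fun k : 'I_N => (k < m)%N)) /= [X in _ + X]big1 ?addr0 //.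
by move=> k; rewrite -leqNgt => /(nilpotent_le M0) ->; rewrite scaler0.
Qed.

Lemma nilexpE n (M : 'M[C]_n) N : M ^+ n = 0 -> (n <= N)%N ->
  nilexp M = truncexp N M.
Proof. by move=> M0 nN; rewrite (truncexp_widen M0 nN). Qed.

Lemma truncexpD n (X Y : 'M[C]_n) m p N :
  GRing.comm X Y -> X ^+ m = 0 -> Y ^+ p = 0 -> (m + p <= N)%N ->
  truncexp N (X + Y) = truncexp N X * truncexp N Y.
Proof.
move=> cXY X0 Y0 mpN.
pose F i j := (j`!%:R^-1 * i`!%:R^-1) *: (X ^+ j * Y ^+ i).
transitivity (\sum_(k < N) \sum_(i < k.+1) F i (k - i)%N).
  apply: eq_bigr => k _; rewrite exprDn_comm // scaler_sumr; apply: eq_bigr => i _.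
  rewrite /F -scalerMnr scalerMnl; congr (_ *: _).
  have ik : (i <= k)%N by rewrite -ltnS.
  have f0 q : (q`!%:R : C) != 0 by rewrite pnatr_eq0 -lt0n fact_gt0.
  apply: (mulfI (f0 k)); rewrite mulrnAr divff //.
  apply: (mulIf (mulf_neq0 (f0 (k - i)%N) (f0 i))).
  rewrite -[RHS]mulrA -invfM mulVf ?mulf_neq0 // mulr1.
  by rewrite -!natrM -(bin_fact ik) [(i`! * _)%N]mulnC.
rewrite sum_triangle /truncexp mulr_sumr; apply: eq_bigr => i _.
have iN : (N - i <= N)%N by rewrite leq_subr.
rewrite mulr_suml (big_ord_widen _ (fun j => F i j) iN) big_mkcond /=.
apply: eq_bigr => j _; rewrite [RHS]mulrmxE -scalemxAl -scalemxAr scalerA /F.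
case: ltnP => // leNij.
have [pi|ip] := leqP p i.
  by rewrite (nilpotent_le Y0 pi) mulmx0 scaler0.
suff mj : (m <= j)%N by rewrite (nilpotent_le X0 mj) mul0mx scaler0.
rewrite leq_subLR in leNij; rewrite -(leq_add2r p) (leq_trans mpN) //.
by rewrite (leq_trans leNij) // addnC leq_add2l ltnW.
Qed.

Lemma truncexp0 n N : truncexp N.+1 (0 : 'M[C]_n) = 1.
Proof.
rewrite /truncexp big_ord_recl /= expr0 invr1 scale1r big1 ?addr0 // => i _.
by rewrite expr0n /= scaler0.
Qed.

Lemma nilexp_unit n (M : 'M[C]_n) : M ^+ n = 0 -> nilexp M \in unitmx.
Proof.
move=> M0; have M0' : (- M) ^+ n = 0 by rewrite exprNn M0 mulr0.
have le1 : (n <= (n + n).+1)%N by rewrite ltnW // ltnS leq_addr.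
suff /mulmx1_unit[] : nilexp M * truncexp (n + n).+1 (- M) = 1 by [].
rewrite (nilexpE M0 le1) -(truncexpD _ M0 M0') ?leqnSn //.
  by rewrite subrr truncexp0.
by rewrite /GRing.comm mulrN mulNr.
Qed.

Lemma expmx_intertwine m n (T : 'M[C]_(m, n)) (M : 'M[C]_n) (M' : 'M[C]_m) k :
  T *m M = M' *m T -> T *m M ^+ k = M' ^+ k *m T.
Proof.
move=> TM; elim: k => [|k IH]; first by rewrite !expr0 mulmx1 mul1mx.
by rewrite !exprSr !mulrmxE mulmxA IH -!mulmxA TM.
Qed.

Lemma nilexp_intertwine m n (T : 'M[C]_(m, n)) (M : 'M[C]_n) (M' : 'M[C]_m) :
  M ^+ n = 0 -> M' ^+ m = 0 -> T *m M = M' *m T ->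
  T *m nilexp M = nilexp M' *m T.
Proof.
move=> M0 M'0 TM.
rewrite (nilexpE M0 (leq_addr m n)) (nilexpE M'0 (leq_addl n m)) /truncexp.
rewrite mulmx_sumr mulmx_suml; apply: eq_bigr => k _.
by rewrite -scalemxAr -scalemxAl (expmx_intertwine _ TM).
Qed.

End NilExp.

Section Connections.
Variable R : realType.
Local Notation C := (CC R).

(* 0 -> C^n' -j-> C^n -p-> C^n'' -> 0 is exact (matrices act on columns). *)
Definition exact_mx n' n n'' (j : 'M[C]_(n, n')) (p : 'M[C]_(n'', n)) : bool :=
  [&& row_full j, row_free p, p *m j == 0 & n == (n' + n'')%N].

Definition mx_hom n n' (N0 N1 : 'M[C]_n) (N0' N1' : 'M[C]_n')
    (T : 'M[C]_(n', n)) : Prop :=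
  T *m N0 = N0' *m T /\ T *m N1 = N1' *m T.

(* (C^n, N0, N1) is an iterated extension of the unit object (C, 0, 0). *)
Inductive unipotent : forall n, 'M[C]_n -> 'M[C]_n -> Prop :=
| unipotent_zero (N0 N1 : 'M[C]_0) : unipotent N0 N1
| unipotent_unit : unipotent (0 : 'M[C]_1) (0 : 'M[C]_1)
| unipotent_ext n' n n'' (N0' N1' : 'M[C]_n') (N0 N1 : 'M[C]_n)
    (N0'' N1'' : 'M[C]_n'') (j : 'M[C]_(n, n')) (p : 'M[C]_(n'', n)) :
    unipotent N0' N1' -> unipotent N0'' N1'' -> exact_mx j p ->
    mx_hom N0' N1' N0 N1 j -> mx_hom N0 N1 N0'' N1'' p -> unipotent N0 N1.

(* An object (V (x) O_X, d + omega) of NC^DR(X_C): dt/t and dt/(t-1) form a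
   basis of H^0(P^1, Omega^1(log D)), so omega = res0 dt/t + res1 dt/(t-1), and
   V = C^cdim.  A morphism extends to the canonical extensions, whose underlying
   bundles are trivial, so it is a linear map V -> V' intertwining the omegas. *)
Record conn := Conn {
  cdim : nat;
  res0 : 'M[C]_cdim;
  res1 : 'M[C]_cdim;
  connP : unipotent res0 res1 }.

Definition conn_hom (E F : conn) (T : 'M[C]_(cdim F, cdim E)) : Prop :=
  mx_hom (res0 E) (res1 E) (res0 F) (res1 F) T.

Definition conn_unit : conn := Conn unipotent_unit.

Lemma tensmxDl m n p q (A A' : 'M[C]_(m, n)) (B : 'M[C]_(p, q)) :
  (A + A') *t B = A *t B + A' *t B.
Proof. by apply/matrixP => i j; rewrite !mxE mulrDl. Qed.

Lemma tensmxDr m n p q (A : 'M[C]_(m, n)) (B B' : 'M[C]_(p, q)) :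
  A *t (B + B') = A *t B + A *t B'.
Proof. by apply/matrixP => i j; rewrite !mxE mulrDr. Qed.

Lemma tensmxZl m n p q a (A : 'M[C]_(m, n)) (B : 'M[C]_(p, q)) :
  (a *: A) *t B = a *: (A *t B).
Proof. by apply/matrixP => i j; rewrite !mxE mulrA. Qed.

Lemma tensmxZr m n p q a (A : 'M[C]_(m, n)) (B : 'M[C]_(p, q)) :
  A *t (a *: B) = a *: (A *t B).
Proof. by apply/matrixP => i j; rewrite !mxE mulrCA. Qed.

Lemma tensmx11 m n : (1%:M : 'M[C]_m) *t (1%:M : 'M[C]_n) = 1%:M.
Proof.
apply/matrixP => i j; case: (mxtens_indexP i) => i0 i1.
case: (mxtens_indexP j) => j0 j1; rewrite tensmxE !mxE -natrM mulnb.
by rewrite (can_eq (@mxtens_indexK _ _)) xpair_eqE.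
Qed.

Definition tens_res m n (M : 'M[C]_m) (N : 'M[C]_n) : 'M[C]_(m * n) :=
  M *t 1%:M + 1%:M *t N.

Lemma unipotent_cast n m (e : n = m) (N0 N1 : 'M[C]_n) :
  unipotent N0 N1 -> unipotent (castmx (e, e) N0) (castmx (e, e) N1).
Proof. by case: m / e => u; rewrite !castmx_id. Qed.

Lemma tens_intertwine m m' n (T : 'M[C]_(m', m)) (M : 'M[C]_m) (M' : 'M[C]_m')
    (N : 'M[C]_n) : T *m M = M' *m T ->
  (T *t 1%:M) *m tens_res M N = tens_res M' N *m (T *t 1%:M).
Proof.
by move=> TM; rewrite mulmxDr mulmxDl !tensmx_mul TM !mulmx1 !mul1mx.
Qed.

Lemma unipotent_tens m n (M0 M1 : 'M[C]_m) (N0 N1 : 'M[C]_n) :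
  unipotent M0 M1 -> unipotent N0 N1 ->
  unipotent (tens_res M0 N0) (tens_res M1 N1).
Proof.
move=> + uN; elim => {m M0 M1}.
- by move=> M0 M1; exact: unipotent_zero.
- rewrite /tens_res !tens0mx !add0r !tens_scalar1mx.
  exact: unipotent_cast.
move=> n' m n'' M0' M1' M0 M1 M0'' M1'' j p _ IH' _ IH'' ex [j0 j1] [p0 p1].
apply: (unipotent_ext (j := j *t 1%:M) (p := p *t 1%:M) IH' IH'');
  try by split; exact: tens_intertwine.
case/and4P: ex => /row_fullP[B jB] /row_freeP[B' pB'] /eqP pj /eqP mE.
apply/and4P; split.
- by apply/row_fullP; exists (B *t 1%:M); rewrite tensmx_mul jB mul1mx tensmx11.
- by apply/row_freeP; exists (B' *t 1%:M); rewrite tensmx_mul pB' mul1mx tensmx11.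
- by rewrite tensmx_mul pj tens0mx.
- by rewrite mE mulnDl.
Qed.

Definition conn_tens (E F : conn) : conn :=
  Conn (unipotent_tens (connP E) (connP F)).

Lemma ext_nilpotent n' n n'' (N' : 'M[C]_n') (N : 'M[C]_n) (N'' : 'M[C]_n'')
    (j : 'M[C]_(n, n')) (p : 'M[C]_(n'', n)) :
  exact_mx j p -> j *m N' = N *m j -> p *m N = N'' *m p ->
  N' ^+ n' = 0 -> N'' ^+ n'' = 0 -> N ^+ n = 0.
Proof.
case/and4P=> jf pf /eqP pj /eqP nE jN pN N'0 N''0.
have pN0 : p *m N ^+ n'' = 0 by rewrite (expmx_intertwine _ pN) N''0 mul0mx.
have sub_ker q (B : 'M[C]_(n, q)) : p *m B = 0 -> (B^T <= kermx p^T)%MS.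
  by move=> pB; apply/sub_kermxP; rewrite -trmx_mul pB trmx0.
have /submxP[L NL] : ((N ^+ n'')^T <= j^T)%MS.
  apply: submx_trans (sub_ker _ _ pN0) _.
  have [_ <-] := mxrank_leqif_sup (sub_ker _ _ pj).
  by rewrite mxrank_ker !mxrank_tr (eqP jf) (eqP pf) nE addnK.
have -> : N ^+ n = N ^+ n' *m N ^+ n'' by rewrite -mulrmxE -exprD -nE.
rewrite -[N ^+ n'']trmxK NL trmx_mul trmxK mulmxA.
by rewrite -(expmx_intertwine _ jN) N'0 mulmx0 mul0mx.
Qed.

Lemma unipotent_nilpotent n (N0 N1 : 'M[C]_n) :
  unipotent N0 N1 -> N0 ^+ n = 0 /\ N1 ^+ n = 0.
Proof.
elim => {n N0 N1}.
- by move=> N0 N1; split; apply/matrixP => -[].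
- by rewrite expr1.
move=> n' n n'' N0' N1' N0 N1 N0'' N1'' j p _ [a0 a1] _ [b0 b1] ex [j0 j1] [p0 p1].
by split; [exact: (ext_nilpotent ex j0 p0)|exact: (ext_nilpotent ex j1 p1)].
Qed.

Lemma res0_nilpotent (E : conn) : (- res0 E) ^+ cdim E = 0.
Proof. by rewrite exprNn (unipotent_nilpotent (connP E)).1 mulr0. Qed.

Lemma res1_nilpotent (E : conn) : (- res1 E) ^+ cdim E = 0.
Proof. by rewrite exprNn (unipotent_nilpotent (connP E)).2 mulr0. Qed.

Lemma exp_tensl m n (M : 'M[C]_m) k :
  (M *t (1%:M : 'M[C]_n)) ^+ k = M ^+ k *t 1%:M.
Proof.
elim: k => [|k IH]; first by rewrite !expr0 tensmx11.
by rewrite !exprSr IH !mulrmxE tensmx_mul mul1mx.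
Qed.

Lemma exp_tensr m n (M : 'M[C]_n) k :
  ((1%:M : 'M[C]_m) *t M) ^+ k = 1%:M *t M ^+ k.
Proof.
elim: k => [|k IH]; first by rewrite !expr0 tensmx11.
by rewrite !exprSr IH !mulrmxE tensmx_mul mul1mx.
Qed.

Lemma truncexp_tensl m n N (M : 'M[C]_m) :
  truncexp N (M *t (1%:M : 'M[C]_n)) = truncexp N M *t 1%:M.
Proof.
rewrite /truncexp; elim: N => [|N IH]; first by rewrite !big_ord0 tens0mx.
by rewrite !big_ord_recr /= IH tensmxDl tensmxZl exp_tensl.
Qed.

Lemma truncexp_tensr m n N (M : 'M[C]_n) :
  truncexp N ((1%:M : 'M[C]_m) *t M) = 1%:M *t truncexp N M.
Proof.
rewrite /truncexp; elim: N => [|N IH]; first by rewrite !big_ord0 tensmx0.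
by rewrite !big_ord_recr /= IH tensmxDr tensmxZr exp_tensr.
Qed.

Lemma nilexp_tens m n (M : 'M[C]_m) (N : 'M[C]_n) :
  M ^+ m = 0 -> N ^+ n = 0 -> tens_res M N ^+ (m * n) = 0 ->
  nilexp (tens_res M N) = nilexp M *t nilexp N.
Proof.
move=> M0 N0 MN0; pose k := (m * n + (m + n))%N.
have mk : (m <= k)%N by rewrite /k addnCA leq_addr.
have nk : (n <= k)%N by rewrite /k addnA leq_addl.
rewrite (nilexpE M0 mk) (nilexpE N0 nk) (nilexpE MN0 (leq_addr (m + n) _)) -/k.
have tl : (M *t (1%:M : 'M[C]_n)) ^+ m = 0 by rewrite exp_tensl M0 tens0mx.
have tr : ((1%:M : 'M[C]_m) *t N) ^+ n = 0 by rewrite exp_tensr N0 tensmx0.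
rewrite (truncexpD _ tl tr) ?leq_addl //.
  by rewrite truncexp_tensl truncexp_tensr mulrmxE tensmx_mul mul1mx mulmx1.
by rewrite /GRing.comm !mulrmxE !tensmx_mul !mul1mx !mulmx1.
Qed.

End Connections.

(* The de Rham fundamental groupoid of X = P^1 \ {0,1,oo}. *)
Section DeRham.
Variable R : realType.
Local Notation C := (CC R).
Local Notation conn := (conn R).

Definition punctured : Type := {z : C | (z != 0) && (z != 1)}.

Inductive basept := Tan01 | Tan10 | Pt of punctured.

(* A C-point of Isom^(x)(omega_p, omega_q).  The fibre of V (x) O_X at a point
   and that of V (x) O_{T_s^x} at t_s = 1 are both V, so a path assigns to each
   E a matrix of size cdim E. *)
Record dR_path (p q : basept) := DRPath {
  dRmx :> forall E : conn, 'M[C]_(cdim E);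
  dR_unit : forall E, dRmx E \in unitmx;
  dR_natural : forall (E F : conn) (T : 'M[C]_(cdim F, cdim E)),
    conn_hom T -> T *m dRmx E = dRmx F *m T;
  dR_tens : forall E F, dRmx (conn_tens E F) = dRmx E *t dRmx F;
  dR_one : dRmx (conn_unit R) = 1%:M }.

(* The identification omega_p = omega_Gamma = omega_q. *)
Definition dR_canon (p q : basept) : dR_path p q.
Proof.
exists (fun E => 1%:M).
- by move=> E; exact: unitmx1.
- by move=> E F T _; rewrite mulmx1 mul1mx.
- by move=> E F; rewrite tensmx11.
- by [].
Defined.

(* First g, then h. *)
Definition dR_comp (p q r : basept) (h : dR_path q r) (g : dR_path p q) :
  dR_path p r.
Proof.
exists (fun E => h E *m g E).
- by move=> E; rewrite unitmx_mul !dR_unit.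
- by move=> E F T hT; rewrite mulmxA (dR_natural h hT) -!mulmxA (dR_natural g hT).
- by move=> E F; rewrite !dR_tens tensmx_mul.
- by rewrite !dR_one mulmx1.
Defined.

Definition dR_inv (p q : basept) (g : dR_path p q) : dR_path q p.
Proof.
exists (fun E => invmx (g E)).
- by move=> E; rewrite unitmx_inv dR_unit.
- move=> E F T hT; apply: (can_inj (mulKmx (dR_unit g F))).
  by rewrite mulKVmx ?dR_unit // mulmxA -(dR_natural g hT) mulmxK ?dR_unit.
- move=> E F; apply: (can_inj (mulKmx (dR_unit g (conn_tens E F)))).
  by rewrite mulmxV ?dR_unit // dR_tens tensmx_mul !mulmxV ?dR_unit // tensmx11.
- by rewrite dR_one invmx1.
Defined.

Lemma opp_tens_res m n (M : 'M[C]_m) (N : 'M[C]_n) :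
  - tens_res M N = tens_res (- M) (- N).
Proof.
by apply/matrixP => i j; rewrite !mxE mulNr mulrN opprD.
Qed.

(* The local monodromy at 0: the image of the exponential of the dual of
   dt_0/t_0, acting on V by exp(-Res_0 omega). *)
Definition dR_x : dR_path Tan01 Tan01.
Proof.
exists (fun E => nilexp (- res0 E)).
- by move=> E; apply/nilexp_unit/res0_nilpotent.
- move=> E F T [T0 _]; apply: nilexp_intertwine; try exact: res0_nilpotent.
  by rewrite mulmxN mulNmx T0.
- move=> E F; rewrite /= opp_tens_res nilexp_tens ?res0_nilpotent //.
  by rewrite -opp_tens_res; exact: (res0_nilpotent (conn_tens E F)).
- by rewrite /nilexp big_ord1 /= expr0 invr1 scale1r.
Defined.

Definition dR_y' : dR_path Tan10 Tan10.
Proof.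
exists (fun E => nilexp (- res1 E)).
- by move=> E; apply/nilexp_unit/res1_nilpotent.
- move=> E F T [_ T1]; apply: nilexp_intertwine; try exact: res1_nilpotent.
  by rewrite mulmxN mulNmx T1.
- move=> E F; rewrite /= opp_tens_res nilexp_tens ?res1_nilpotent //.
  by rewrite -opp_tens_res; exact: (res1_nilpotent (conn_tens E F)).
- by rewrite /nilexp big_ord1 /= expr0 invr1 scale1r.
Defined.

Definition dR_d : dR_path Tan01 Tan10 := dR_canon Tan01 Tan10.

Definition dR_dz (z : punctured) : dR_path Tan01 (Pt z) := dR_canon Tan01 (Pt z).

Definition dR_y : dR_path Tan01 Tan01 :=
  dR_comp (dR_inv dR_d) (dR_comp dR_y' dR_d).

(* The embedding i of the pro-algebraic group pi_1^DR(X:01) into C<<A,B>>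
   determined by x |-> e^A and y |-> e^B.  The regular functions on the
   Tannakian group are the matrix coefficients g |-> tr(L g_E), so
   [dRemb_regular] says that i is a morphism of pro-algebraic groups, without
   which the values at x and y would not determine i. *)
Record dR_embedding := DREmbedding {
  dRemb :> dR_path Tan01 Tan01 -> ncseries R;
  dRemb_inj : injective dRemb;
  dRemb_mul : forall h g, dRemb (dR_comp h g) = dRemb h * dRemb g;
  dRemb_regular : forall w : seq bool, exists (E : conn) (L : 'M[C]_(cdim E)),
    forall g, dRemb g w = \tr (L *m g E);
  dRemb_x : dRemb dR_x = ser_exp serA;
  dRemb_y : dRemb dR_y = ser_exp serB }.

End DeRham.
Arguments Tan01 {R}.
Arguments Tan10 {R}.

Section Analysis.
Variable R : realType.
Local Notation C := (CC R).
Local Notation conn := (conn R).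

(* Principal logarithm, argument in ]-pi, pi]. *)
Definition Arg (z : C) : R :=
  let a := acos (complex.Re z / complex.Re `|z|) in
  if 0 <= complex.Im z then a else - a.

Definition Log (z : C) : C := Complex (ln (complex.Re `|z|)) (Arg z).

(* C minus the half-line ]-oo, 0] *)
Definition slit (t : C) : bool := (0 < complex.Re t) || (complex.Im t != 0).

(* C minus the half-lines ]-oo, 0] and [1, +oo[ *)
Definition bislit (t : C) : bool :=
  (0 < complex.Re t < 1) || (complex.Im t != 0).

(* A path in X(C) from the tangential base point 01 to z: it leaves 0 with
   velocity 1 in the coordinate t_0 = t. *)
Definition tangential_path (b : R -> C) (z : punctured R) : Prop :=
  [/\ {within `[0, 1], continuous b},
      b 0 = 0,
      b s / (s%:C)%C @[s --> 0^'+] --> (1 : C),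
      forall s : R, 0 < s <= 1 -> (b s != 0) && (b s != 1)
    & b 1 = val z].

(* For a sheaf on X(C) of T-valued functions whose sections are the functions f
   with [sec f t] at every point t: the section f, given near the beginning of
   b, can be continued along b, and the continuation takes the value v at b 1. *)
Definition continuation (T : Type) (sec : (C -> T) -> C -> Prop)
    (b : R -> C) (f : C -> T) (v : T) : Prop :=
  exists F : R -> C -> T,
  [/\ forall s : R, 0 < s <= 1 -> \forall t \near b s, sec (F s) t,
      forall s : R, 0 < s <= 1 -> \forall s' \near s, s' <= 1 ->
        \forall t \near b s', F s' t = F s t,
      \forall s \near (0 : R)^'+, \forall t \near b s, F s t = f t
    & F 1 (b 1) = v].

Definition holomorphic_at (f : C -> C) (t : C) : Prop := derivable f t (1 : C).

(* Horizontal sections of (V (x) O_X, d + omega): df = - omega f. *)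
Definition horizontal_at (E : conn) (f : C -> 'cV[C]_(cdim E)) (t : C) : Prop :=
  forall k, is_derive t (1 : C) (fun u => f u k 0)
    ((- (t^-1 *: res0 E + (t - 1)^-1 *: res1 E) *m f t) k 0).

(* f is a horizontal section near 0 (off the cut of Log) corresponding to the
   vector v in the fibre at 01: f(t) = P(t) t^(- Res_0 omega) v, P holomorphic
   at 0, P(0) = 1. *)
Definition tangential_section (E : conn) (v : 'cV[C]_(cdim E))
    (f : C -> 'cV[C]_(cdim E)) : Prop :=
  (\forall t \near (0 : C), slit t -> horizontal_at f t) /\
  exists P : C -> 'M[C]_(cdim E),
  [/\ \forall t \near (0 : C), forall k l, holomorphic_at (fun u => P u k l) t,
      P 0 = 1%:M
    & \forall t \near (0 : C), slit t ->
        f t = P t *m nilexp (- Log t *: res0 E) *m v].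

(* The de Rham path g corresponds to the topological path b under the Hodge
   comparison isomorphism: on every E, g is the transport along b in the local
   system of horizontal sections of E, its fibres at 01 and z being identified
   with V by [tangential_section] and by evaluation at z. *)
Definition hodge_comparison (b : R -> C) (z : punctured R)
    (g : dR_path Tan01 (Pt z)) : Prop :=
  forall (E : conn) (v : 'cV[C]_(cdim E)),
  exists2 f, tangential_section v f & continuation (@horizontal_at E) b f (g E *m v).

(* The fundamental solution G_0 of the KZ equation, on the simply connected
   domain [bislit] containing ]0, 1[. *)
Definition KZ_fundamental (G : C -> ncseries R) : Prop :=
  (forall t, bislit t -> forall w, is_derive t (1 : C) (fun u => G u w)
     (((t^-1 *: serA + (t - 1)^-1 *: serB) * G t) w)) /\
  exists P : C -> ncseries R,
  [/\ forall w, \forall t \near (0 : C), holomorphic_at (fun u => P u w) t,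
      P 0 = 1
    & forall w, \forall t \near (0 : C), slit t ->
        G t w = (P t * ser_exp (Log t *: serA)) w].

(* S is the value at the end of b of the (coefficientwise) analytic
   continuation of G along b. *)
Definition continued_value (b : R -> C) (G : C -> ncseries R) (S : ncseries R) :
    Prop :=
  forall w, continuation holomorphic_at b (fun t => G t w) (S w).

End Analysis.

(* Main.v *)
Require Import Defs.
From mathcomp Require Import all_boot all_order all_algebra.
From mathcomp Require Import all_classical all_reals all_analysis.
From mathcomp Require Import complex zify ring lra.

(* On the quotient of C<<A,B>> by a finite-codimensional left ideal, left
   multiplication by A and B defines a unipotent connection with residues -A
   and -B, and any de Rham path g acts on it as left multiplication by a series
   S(g).  These connections are generated by the empty word and map onto every
   vector of every object, so g acts on any E as the sum of the S(g)_w w; hence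
   the regular functions on the fundamental group are linear forms of finite
   support in S(g).  Since S is multiplicative with S(x) = e^A and S(y) = e^B,
   and since no such form kills the monoid generated by e^A and e^B, the
   embedding i is S.

   A horizontal section of such a connection starting at 1 satisfies the KZ
   equation coefficientwise.  The coefficient of w of its difference with G_0
   has zero derivative as soon as the shorter coefficients vanish, so it is
   constant along the rays from 0, and its value at t is a combination of terms
   Q(t) (log t)^k with Q holomorphic and Q(0) = 0, which tends to 0.  The
   continuation of the section along b is then one of G_0, and it ends at
   S(b_z). *)

Set Implicit Arguments.
Unset Strict Implicit.
Unset Printing Implicit Defensive.

Import Order.TTheory GRing.Theory Num.Theory.
Import numFieldNormedType.Exports.

Local Open Scope classical_set_scope.
Local Open Scope ring_scope.

(** * Numbering of words *)

(* Words are numbered in binary heap order, shorter words first. *)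
Fixpoint wcode (w : seq bool) : nat :=
  if w is c :: w' then ((wcode w').*2.+1 + c)%N else 0%N.

(** The recursive call on [k'./2] is not structural in [k'.+1], hence the fuel; since codes at least
    halve at each step, fuel [k] suffices for the code [k]. *)
Fixpoint wdecode (fuel k : nat) : seq bool :=
  match fuel, k with
  | f.+1, k'.+1 => odd k' :: wdecode f k'./2
  | _, _ => [::]
  end.

Definition word (k : nat) : seq bool := wdecode k k.
Arguments word : simpl never.

Lemma wdecodeK fuel k : (k <= fuel)%N -> wcode (wdecode fuel k) = k.
Proof.
elim: fuel k => [|f IH] [|k] //= kf.
rewrite IH; last by lia.
by rewrite addSn addnC odd_double_half.
Qed.

Lemma wordK : cancel word wcode.
Proof. by move=> k; exact: wdecodeK. Qed.

Lemma wcode_inj : injective wcode.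
Proof.
elim=> [|c w IH] [|c' w'] //=; rewrite ?addSn //.
move=> [] h; have e : c = c'.
  by move/(congr1 odd): h; rewrite !oddD !odd_double /=; case: c; case: c'.
by rewrite e in h *; rewrite (IH w') //; lia.
Qed.

Lemma wcodeK : cancel wcode word.
Proof. by move=> w; apply: wcode_inj; rewrite wordK. Qed.

Lemma wcode_cat u v : (wcode u <= wcode (u ++ v))%N.
Proof. by elim: u => //= c u IH; rewrite leq_add2r ltnS leq_double. Qed.

Lemma size_wcode w : (size w <= wcode w)%N.
Proof. by elim: w => //= c w IH; lia. Qed.

(** Used in contrapositive form: a word of code at least [2 ^ d] has at least [d] letters, hence
    acts by 0 on an object of dimension [d]. *)
Lemma wcode_lt w d : (size w < d)%N -> (wcode w < 2 ^ d)%N.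
Proof.
move=> h; have : (wcode w + 2 <= 2 ^ (size w).+1)%N.
  (* The extra 2 makes the induction close: doubling [wcode w + 2] leaves room for the added
     [1 + c]. *)
  elim: w {h} => //= c w IH; rewrite expnS; case: c; lia.
have : (2 ^ (size w).+1 <= 2 ^ d)%N by rewrite leq_exp2l.
lia.
Qed.

(** * Coefficients of products and exponentials of series *)

Section WordSeries.
Variable R : realType.
Local Notation C := (CC R).
Local Notation ser := (ncseries R).

Lemma serD (S T : ser) w : (S + T) w = S w + T w. Proof. by []. Qed.
Lemma serN (S : ser) w : (- S) w = - S w. Proof. by []. Qed.
Lemma serZ a (S : ser) w : (a *: S) w = a * S w. Proof. by []. Qed.

Lemma ser_sumE (I : Type) (r : seq I) (P : pred I) (F : I -> ser) w :
  (\sum_(i <- r | P i) F i) w = \sum_(i <- r | P i) F i w.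
Proof. exact: (big_morph (fun S : ser => S w)). Qed.

Lemma serM (S T : ser) w :
  (S * T) w = \sum_(k < (size w).+1) S (take k w) * T (drop k w).
Proof. by []. Qed.

Lemma ser_scaleAl a (S T : ser) : a *: S * T = a *: (S * T).
Proof.
apply/funext => w; rewrite serZ !serM mulr_sumr.
by apply: eq_bigr => k _; rewrite serZ mulrA.
Qed.

Lemma ser_scaleAr a (S T : ser) : S * (a *: T) = a *: (S * T).
Proof.
apply/funext => w; rewrite serZ !serM mulr_sumr.
by apply: eq_bigr => k _; rewrite serZ mulrCA.
Qed.

Definition ser_letter (c : bool) : ser := if c then serB else serA.

Definition ser_word (u : seq bool) : ser := fun w => (w == u)%:R.

Lemma ser_letterE c : ser_letter c = ser_word [:: c].
Proof. by case: c. Qed.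

Lemma ser_letterM_nil c (S : ser) : (ser_letter c * S) [::] = 0.
Proof. by rewrite serM big_ord1 ser_letterE /ser_word /= mul0r. Qed.

Lemma ser_letterM_cons c (S : ser) d w :
  (ser_letter c * S) (d :: w) = (d == c)%:R * S w.
Proof.
rewrite serM big_ord_recl big_ord_recl big1 /= => [|k _].
  by rewrite ser_letterE /ser_word /= mul0r add0r addr0 take0 drop0 eqseq_cons andbT.
rewrite ser_letterE /ser_word /= eqseq_cons /bump /= add1n.
by case: w k => [[]//|e w] k /=; rewrite andbF mul0r.
Qed.

Lemma ser_letterM_word c u : ser_letter c * ser_word u = ser_word (c :: u).
Proof.
apply/funext => -[|d w]; first by rewrite ser_letterM_nil.
by rewrite ser_letterM_cons /ser_word eqseq_cons -natrM mulnb.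
Qed.

Lemma ser_letterX_short c k w : (size w < k)%N -> (ser_letter c ^+ k) w = 0.
Proof.
elim: k w => // k IH [|d w] h; rewrite exprS; first exact: ser_letterM_nil.
by rewrite ser_letterM_cons IH ?mulr0.
Qed.

Lemma ser_expE (a : C) c w N : (size w < N)%N ->
  ser_exp (a *: ser_letter c) w =
  \sum_(k < N) (k`!%:R^-1 * a ^+ k) * (ser_letter c ^+ k) w.
Proof.
move=> wN; have aX k : (a *: ser_letter c) ^+ k = a ^+ k *: ser_letter c ^+ k.
  elim: k => [|k IH]; first by rewrite !expr0 scale1r.
  by rewrite !exprS IH ser_scaleAl ser_scaleAr scalerA.
pose F k := (k`!%:R^-1 * a ^+ k) * (ser_letter c ^+ k) w.
rewrite -[RHS]/(\sum_(k < N) F k) /ser_exp.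
transitivity (\sum_(k < (size w).+1) F k).
  by apply: eq_bigr => k _; rewrite aX serZ mulrA.
rewrite (big_ord_widen _ _ wN) big_mkcond /=.
apply: eq_bigr => k _; case: ifP => // /negbT; rewrite -leqNgt => h.
by rewrite /F ser_letterX_short ?mulr0.
Qed.

(** A prefix of [w] has code at most that of [w], so only the part of [S] supported on codes [< n]
    contributes. *)
Lemma ser_mul_trunc n (S T : ser) w : (wcode w < n)%N ->
  (S * T) w = \sum_(k < n) S (word k) * (ser_word (word k) * T) w.
Proof.
move=> wn; pose S' : ser := \sum_(k < n) S (word k) *: ser_word (word k).
have S'E u : (wcode u < n)%N -> S' u = S u.
  move=> un; rewrite /S' ser_sumE (bigD1 (Ordinal un)) //= big1 => [|k kn].
    by rewrite serZ /ser_word wcodeK eqxx mulr1 addr0.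
  rewrite serZ /ser_word; case: eqP => [e|]; last by rewrite mulr0.
  by case/eqP: kn; apply/val_inj; rewrite /= e wordK.
transitivity ((S' * T) w).
  rewrite !serM; apply: eq_bigr => k _; rewrite S'E //.
  apply: leq_ltn_trans wn; have := wcode_cat (take k w) (drop k w).
  by rewrite cat_take_drop.
rewrite /S' mulr_suml ser_sumE; apply: eq_bigr => k _.
by rewrite ser_scaleAl serZ.
Qed.

(** That is, [S] equals [u] plus terms strictly longer than [u]. *)
Definition leading (u : seq bool) (S : ser) : Prop :=
  forall v, (size v <= size u)%N -> S v = (v == u)%:R.

(** Only the cut at [size u] can contribute: an earlier one leaves a prefix too short for [S], a
    later one a suffix too short for [S']. *)
Lemma leadingM u u' S S' :
  leading u S -> leading u' S' -> leading (u ++ u') (S * S').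
Proof.
move=> lS lS' v; rewrite size_cat => vs; rewrite serM.
have zk (k : 'I_(size v).+1) : k != size u :> nat ->
    S (take k v) * S' (drop k v) = 0.
  have kv : (k <= size v)%N by rewrite -ltnS.
  case: ltngtP => // h _.
    rewrite lS ?size_takel // ?(ltnW h) //; case: eqP => [e|]; last by rewrite mul0r.
    by move/(congr1 size): e h; rewrite size_takel // => ->; rewrite ltnn.
  have dk : (size (drop k v) < size u')%N by rewrite size_drop; lia.
  rewrite lS' ?(ltnW dk) //; case: eqP => [e|]; last by rewrite mulr0.
  by move: dk; rewrite e ltnn.
have [uv|vu] := leqP (size u) (size v); last first.
  rewrite big1 => [|k _]; last by apply: zk; have := ltn_ord k; lia.
  by case: eqP => // e; move: vu; rewrite e size_cat; lia.
rewrite (bigD1 (Ordinal (uv : (size u < (size v).+1)%N))) //= big1 => [|k kn].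
  rewrite addr0 lS ?size_takel // lS' ?size_drop; last by lia.
  rewrite -natrM mulnb -[in RHS](cat_take_drop (size u) v) eqseq_cat //.
  by rewrite size_takel.
by apply: zk; apply: contra kn => /eqP e; apply/eqP/val_inj.
Qed.

Lemma leading_exp c : leading [::] (ser_exp (ser_letter c)).
Proof.
move=> [|//] _; rewrite -[ser_letter c]scale1r (@ser_expE 1 c [::] 1) //.
by rewrite big_ord1 /= !expr0 invr1 !mul1r.
Qed.

Lemma leading_exp_sub1 c : leading [:: c] (ser_exp (ser_letter c) - 1).
Proof.
move=> v sv; rewrite serD serN -[ser_letter c]scale1r (@ser_expE 1 c v 2) //.
rewrite !big_ord_recl big_ord0 /= !expr0 !expr1n !mulr1 invr1 !mul1r addr0.
by rewrite addrAC subrr add0r ser_letterE.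
Qed.

End WordSeries.

(** * Word connections and the series of a de Rham path *)

Section WordConnection.
Variable R : realType.
Local Notation C := (CC R).
Local Notation ser := (ncseries R).
Local Notation conn := (conn R).

(* Left multiplication by a letter on the quotient of C<<A,B>> with basis the
   words of code < n; words of code >= n span a left ideal. *)
Definition lmx n (c : bool) : 'M[C]_n :=
  \matrix_(i, j) ((i : nat) == (j.*2.+1 + c)%N)%:R.

Definition ser_col n (S : ser) : 'cV[C]_n := \col_k S (word k).

(** Removing the first letter lowers the code, so the coefficients that determine entry [k] survive
    the truncation. *)
Lemma lmx_col n c (S : ser) : lmx n c *m ser_col n S = ser_col n (ser_letter R c * S).
Proof.
apply/matrixP => k l; rewrite !mxE; have ek := wordK k; move: ek.
case: (word k) => [|d w] /= ek.
  rewrite ser_letterM_nil big1 // => j _.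
  by rewrite !mxE -ek addSn mul0r.
rewrite ser_letterM_cons; have wn : (wcode w < n)%N by have := ltn_ord k; lia.
rewrite (bigD1 (Ordinal wn)) //= big1 => [|j jw]; rewrite !mxE -ek.
  by rewrite wcodeK addr0 /= eqn_add2l {ek}; case: c; case: d.
case: eqP => [e|]; last by rewrite mul0r.
by case/eqP: jw; apply/val_inj => /=; move: e ; case: c; case: d {ek}; lia.
Qed.

Lemma mul_ser_col1 m n (M : 'M[C]_(m, n.+1)) : M *m ser_col n.+1 1 = col ord0 M.
Proof.
apply/matrixP => i k; rewrite !mxE (bigD1 ord0) //= big1 ?addr0 => [|l l0].
  by rewrite mxE mulr1.
rewrite mxE /GRing.one /= /ser_one; case: eqP => [e|]; last by rewrite mulr0.
by case/eqP: l0; apply/val_inj; rewrite /= -(wordK l) e.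
Qed.

Definition trunc_mx m n : 'M[C]_(m, n) := \matrix_(i, k) ((i : nat) == k)%:R.

Lemma trunc_mx_mul m n q (mn : (m <= n)%N) (M : 'M[C]_(n, q)) i k :
  (trunc_mx m n *m M) i k = M (widen_ord mn i) k.
Proof.
rewrite mxE (bigD1 (widen_ord mn i)) //= big1 ?addr0 => [|l li].
  by rewrite !mxE eqxx mul1r.
rewrite !mxE; case: eqP => [e|]; last by rewrite mul0r.
by case/eqP: li; apply/val_inj.
Qed.

Lemma mul_trunc_mx m n q (M : 'M[C]_(q, m)) i (k : 'I_m) (k' : 'I_n) :
  k = k' :> nat -> (M *m trunc_mx m n) i k' = M i k.
Proof.
move=> kk'; rewrite mxE (bigD1 k) //= big1 ?addr0 => [|l lk].
  by rewrite !mxE kk' eqxx mulr1.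
rewrite !mxE; case: eqP => [e|]; last by rewrite mulr0.
by case/eqP: lk; apply/val_inj; rewrite /= kk' e.
Qed.

(** A letter sends a word of code [k] to one of code greater than [k]; hence a word of code at least
    [m] stays among the discarded ones. *)
Lemma trunc_mx_lmx m n c : (m <= n)%N ->
  trunc_mx m n *m lmx n c = lmx m c *m trunc_mx m n.
Proof.
move=> mn; apply/matrixP => i k; rewrite trunc_mx_mul.
have [km|km] := ltnP k m; first by rewrite (@mul_trunc_mx _ _ _ _ _ (Ordinal km)) // !mxE.
rewrite !mxE big1 => [|l _].
  by case: eqP => //= e; have := ltn_ord i; lia.
rewrite !mxE mulrC; case: eqP => [e|]; last by rewrite mul0r.
by have := ltn_ord l; lia.
Qed.

(** In the quotient of dimension [n.+1], both letters kill the word of code [n], whose successors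
    are cut off. It spans a copy of the unit object, and dividing by it leaves the quotient of
    dimension [n]. *)
Lemma unipotent_lmx n : unipotent (- lmx n false) (- lmx n true).
Proof.
elim: n => [|n IH]; first exact: unipotent_zero.
pose j : 'M[C]_(n.+1, 1) := \matrix_(i, _) ((i : nat) == n)%:R.
pose p := trunc_mx n n.+1.
have jl c : j *m 0 = - lmx n.+1 c *m j.
  apply/matrixP => i k; rewrite mulmx0 mulNmx !mxE big1 ?oppr0 // => l _.
  rewrite !mxE; case: eqP => [e|]; last by rewrite mul0r.
  case: eqP => [e'|]; last by rewrite mulr0.
  by have := ltn_ord i; lia.
have pl c : p *m - lmx n.+1 c = - lmx n c *m p.
  by rewrite mulmxN mulNmx trunc_mx_lmx.
apply: (unipotent_ext (j := j) (p := p) (unipotent_unit R) IH); try by split.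
apply/and4P; split; last by rewrite add1n.
- apply/row_fullP; exists (\matrix_(_, i) ((i : nat) == n)%:R).
  apply/matrixP => i k; rewrite !ord1 !mxE (bigD1 ord_max) //= big1 => [|l lk].
    by rewrite !mxE !eqxx mulr1 addr0.
  rewrite !mxE; case: eqP => [e|]; last by rewrite mul0r.
  by case/eqP: lk; apply/val_inj.
- apply/row_freeP; exists (trunc_mx n n.+1)^T.
  apply/matrixP => i k; rewrite trunc_mx_mul !mxE /=.
  by rewrite eq_sym.
- apply/eqP/matrixP => i k; rewrite trunc_mx_mul !mxE /=.
  by case: eqP => // e; have := ltn_ord i; lia.
Qed.

Definition word_conn n : conn := Conn (unipotent_lmx n.+1).

(* The letter c acts by minus the residue, as x and y do to first order. *)
Definition word_act n (N0 N1 : 'M[C]_n) (w : seq bool) : 'M[C]_n :=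
  foldr (fun (c : bool) M => - (if c then N1 else N0) *m M) 1%:M w.

Lemma word_act_cat n (N0 N1 : 'M[C]_n) u v :
  word_act N0 N1 (u ++ v) = word_act N0 N1 u *m word_act N0 N1 v.
Proof.
elim: u => [|c u IH] /=; first by rewrite mul1mx.
by rewrite IH mulmxA.
Qed.

Lemma word_act_hom n n' (N0 N1 : 'M[C]_n) (N0' N1' : 'M[C]_n') (T : 'M[C]_(n', n)) w :
  mx_hom N0 N1 N0' N1' T -> T *m word_act N0 N1 w = word_act N0' N1' w *m T.
Proof.
move=> [T0 T1]; elim: w => [|c w IH] /=; first by rewrite mulmx1 mul1mx.
by case: c; rewrite mulmxA mulmxN (T0, T1) -mulNmx -!mulmxA IH.
Qed.

Lemma unipotent_word_act n (N0 N1 : 'M[C]_n) w :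
  unipotent N0 N1 -> (n <= size w)%N -> word_act N0 N1 w = 0.
Proof.
move=> u; elim: u w => {n N0 N1}.
- by move=> N0 N1 w _; apply/matrixP => -[].
- by case=> //= c w _; rewrite if_same oppr0 mul0mx.
move=> n' n n'' N0' N1' N0 N1 N0'' N1'' j p _ IH' _ IH'' ex hj hp w nw.
case/and4P: ex => jf pf /eqP pj /eqP nE.
rewrite -(cat_take_drop n' w) word_act_cat.
(* The last letters act first: at least [n''] of them kill the quotient, so their image lies in that
   of [j], which the first [n'] letters kill. *)
have pW : p *m word_act N0 N1 (drop n' w) = 0.
  by rewrite (word_act_hom _ hp) IH'' ?mul0mx // size_drop; lia.
have sub_ker q (B : 'M[C]_(n, q)) : p *m B = 0 -> (B^T <= kermx p^T)%MS.
  by move=> pB; apply/sub_kermxP; rewrite -trmx_mul pB trmx0.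
have /submxP[L WL] : ((word_act N0 N1 (drop n' w))^T <= j^T)%MS.
  apply: submx_trans (sub_ker _ _ pW) _.
  have [_ <-] := mxrank_leqif_sup (sub_ker _ _ pj).
  by rewrite mxrank_ker !mxrank_tr (eqP jf) (eqP pf) nE addnK.
rewrite -[word_act _ _ (drop _ _)]trmxK WL trmx_mul trmxK mulmxA.
by rewrite -(word_act_hom _ hj) IH' ?mulmx0 ?mul0mx // size_takel //; lia.
Qed.

Section Paths.
Variables p q : basept R.

(** The series S(g): the coefficient of [w] is read in the smallest quotient containing [w], where
    [w] is the last basis vector and the empty word the first. *)
Definition path_ser (g : dR_path p q) : ser :=
  fun w => g (word_conn (wcode w)) ord_max ord0.

Lemma word_conn_trunc m n : (m <= n)%N ->
  @conn_hom _ (word_conn n) (word_conn m) (trunc_mx m.+1 n.+1).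
Proof. by move=> mn; split; rewrite /= mulmxN mulNmx trunc_mx_lmx. Qed.

(** Naturality under truncation makes the coefficient independent of the quotient in which it is
    read. *)
Lemma path_ser_word_conn (g : dR_path p q) n (k : 'I_n.+1) :
  g (word_conn n) k ord0 = path_ser g (word k).
Proof.
have kn : (wcode (word k) <= n)%N by rewrite wordK -ltnS.
have /matrixP /(_ ord_max ord0) := dR_natural g (word_conn_trunc kn).
rewrite (trunc_mx_mul (m := _.+1) (n := _.+1) kn).
rewrite (@mul_trunc_mx _.+1 _.+1 _ _ _ ord0) // /path_ser => <-.
by congr (dRmx g _ _ _); apply/val_inj; rewrite /= wordK.
Qed.

Lemma path_ser_col (g : dR_path p q) n :
  g (word_conn n) *m ser_col n.+1 1 = ser_col n.+1 (path_ser g).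
Proof.
by rewrite mul_ser_col1; apply/matrixP => k l; rewrite !mxE path_ser_word_conn.
Qed.

(** The map sending a word to its action on [v], and so the empty word to [v]. *)
Definition cyclic_mx (E : conn) (v : 'cV[C]_(cdim E)) n : 'M[C]_(cdim E, n) :=
  \matrix_(i, k) (word_act (res0 E) (res1 E) (word k) *m v) i 0.

Lemma cyclic_hom (E : conn) (v : 'cV[C]_(cdim E)) n : (2 ^ cdim E <= n.+1)%N ->
  @conn_hom _ (word_conn n) E (cyclic_mx v n.+1).
Proof.
move=> dn; suff H c : cyclic_mx v n.+1 *m - lmx n.+1 c =
    (if c then res1 E else res0 E) *m cyclic_mx v n.+1.
  by split; [exact: (H false)|exact: (H true)].
apply/matrixP => i k; set N := if c then _ else _.
have wk : word (k.*2.+1 + c) = c :: word k.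
  by apply: wcode_inj; rewrite wordK /= wordK.
transitivity ((N *m (word_act (res0 E) (res1 E) (word k) *m v)) i 0); last first.
  by rewrite !mxE; apply: eq_bigr => l _; rewrite !mxE.
have actc : word_act (res0 E) (res1 E) (c :: word k) *m v =
    - (N *m (word_act (res0 E) (res1 E) (word k) *m v)).
  by rewrite /= !mulNmx mulmxA.
rewrite mulmxN mxE mxE; have [kn|kn] := ltnP (k.*2.+1 + c) n.+1.
  rewrite (bigD1 (Ordinal kn)) //= big1 ?addr0 => [|l lk].
    have -> : lmx n.+1 c (Ordinal kn) k = 1 by rewrite mxE eqxx.
    by rewrite mulr1 [cyclic_mx _ _ _ _]mxE [nat_of_ord _]/= wk actc mxE opprK.
  rewrite !mxE; case: eqP => [e|]; last by rewrite mulr0.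
  by case/eqP: lk; apply/val_inj.
(* Here the successor of [word k] is cut off. Its code is at least [2 ^ cdim E], so it acts by 0 on
   [E] as well. *)
rewrite big1 => [|l _].
  have : word_act (res0 E) (res1 E) (c :: word k) = 0.
    apply: unipotent_word_act (connP E) _; rewrite leqNgt; apply/negP.
    by move=> /wcode_lt; rewrite -wk wordK; lia.
  move=> a0; rewrite a0 mul0mx in actc.
  by rewrite -[N *m _]opprK -actc !oppr0 mxE.
rewrite !mxE; case: eqP => [e|]; last by rewrite mulr0.
by have := ltn_ord l; lia.
Qed.

(** Each basis vector of [E] is the image of the empty word under a [cyclic_mx]; naturality
    transports to [E] the value of [g] on the empty word, which is S(g). *)
Lemma path_expand (g : dR_path p q) (E : conn) n : (2 ^ cdim E <= n.+1)%N ->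
  g E = \sum_(k < n.+1) path_ser g (word k) *: word_act (res0 E) (res1 E) (word k).
Proof.
move=> dn; apply/trmx_inj/row_matrixP => i; rewrite -!tr_col; congr (_^T).
rewrite !colE; set v := delta_mx i 0.
have vE : v = cyclic_mx v n.+1 *m ser_col n.+1 1.
  rewrite mul_ser_col1; apply/matrixP => k l; rewrite ord1 [RHS]mxE [RHS]mxE.
  by rewrite (_ : word (ord0 : 'I_n.+1) = [::]) //= mul1mx.
rewrite {1}vE mulmxA -(dR_natural g (cyclic_hom v dn)) -mulmxA path_ser_col.
apply/matrixP => k l; rewrite ord1 mulmx_suml [LHS]mxE summxE.
apply: eq_bigr => m _; rewrite -scalemxAl [RHS]mxE mulrC.
by rewrite [cyclic_mx _ _ _ _]mxE [ser_col _ _ _ _]mxE.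
Qed.

End Paths.

Lemma word_conn_act n w (S : ser) :
  word_act (res0 (word_conn n)) (res1 (word_conn n)) w *m ser_col n.+1 S =
  ser_col n.+1 (ser_word R w * S).
Proof.
elim: w => [|c w IH]; first by rewrite mul1mx [ser_word _ _](_ : _ = 1) ?mul1r.
rewrite [word_act _ _ _]/= -mulmxA IH -ser_letterM_word -mulrA -lmx_col.
by case: c; rewrite opprK.
Qed.

Lemma path_serM p q r (h : dR_path q r) (g : dR_path p q) :
  path_ser (dR_comp h g) = path_ser h * path_ser g.
Proof.
(* The object [word_conn m] has dimension [m.+1], so [2 ^ m.+1] is the number of words that
   [path_expand] asks for. *)
apply/funext => w; pose m := wcode w; pose n := (2 ^ m.+1)%N.
have wn : (wcode w < n.+1)%N.
  by rewrite ltnS ltnW // (leq_trans (ltnSn _)) // ltnW // ltn_expl.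
have -> : path_ser (dR_comp h g) w =
    (h (word_conn m) *m (g (word_conn m) *m ser_col m.+1 1)) ord_max ord0.
  by rewrite mulmxA mul_ser_col1 mxE.
rewrite path_ser_col (@path_expand _ _ h (word_conn m) n) ?leqnSn //.
rewrite mulmx_suml summxE (ser_mul_trunc _ _ wn); apply: eq_bigr => k _.
by rewrite -scalemxAl mxE word_conn_act mxE wcodeK.
Qed.

(** The two exponentials are truncated at different orders, which is harmless: a word of code [< n]
    has fewer than [n] letters. *)
Lemma nilexp_lmx n c (a : C) :
  nilexp (a *: lmx n c) *m ser_col n 1 = ser_col n (ser_exp (a *: ser_letter R c)).
Proof.
have lmxX k : lmx n c ^+ k *m ser_col n 1 = ser_col n (ser_letter R c ^+ k).
  elim: k => [|k IH]; first by rewrite !expr0 mul1mx.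
  by rewrite !exprS mulrmxE -mulmxA IH lmx_col.
apply/matrixP => i l; rewrite [RHS]mxE (@ser_expE _ a c (word i) n); last first.
  by rewrite (leq_ltn_trans (size_wcode _)) // wordK.
rewrite mulmx_suml summxE; apply: eq_bigr => k _.
have -> : (a *: lmx n c) ^+ k = a ^+ k *: lmx n c ^+ k.
  elim: (nat_of_ord k) => [|j IH]; first by rewrite !expr0 scale1r.
  by rewrite !exprS IH !mulrmxE -scalemxAl -scalemxAr scalerA.
by rewrite scalerA -scalemxAl lmxX !mxE.
Qed.

Lemma path_ser_x : path_ser (dR_x R) = ser_exp serA.
Proof.
apply/funext => w; rewrite /path_ser.
transitivity ((nilexp (1 *: lmx (wcode w).+1 false) *m ser_col _ 1) ord_max ord0).
  by rewrite mul_ser_col1 mxE /= scale1r opprK.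
by rewrite nilexp_lmx mxE wcodeK scale1r.
Qed.

Lemma path_ser_y : path_ser (dR_y R) = ser_exp serB.
Proof.
apply/funext => w; rewrite /path_ser.
transitivity ((nilexp (1 *: lmx (wcode w).+1 true) *m ser_col _ 1) ord_max ord0).
  by rewrite mul_ser_col1 [RHS]mxE /= invmx1 mul1mx mulmx1 scale1r opprK.
by rewrite nilexp_lmx mxE wcodeK scale1r.
Qed.

Definition dR_letter (c : bool) : dR_path Tan01 Tan01 := if c then dR_y R else dR_x R.

Lemma path_ser_letter c : path_ser (dR_letter c) = ser_exp (ser_letter R c).
Proof. by case: c; [exact: path_ser_y|exact: path_ser_x]. Qed.

(* The products of the (e^c - 1), c = A, B, are triangular with respect to
   word length: no linear form of finite support kills the monoid generated by
   e^A and e^B. *)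
Lemma dR_letter_dense (P : dR_path Tan01 Tan01 -> Prop) n (d : nat -> C) :
  P (dR_x R) -> (forall h c, P h -> P (dR_comp h (dR_letter c))) ->
  (forall h, P h -> \sum_(k < n) d k * path_ser h (word k) = 0) ->
  forall k, (k < n)%N -> d k = 0.
Proof.
move=> Px Pc Pd; pose mu (S : ser) := \sum_(k < n) d k * S (word k).
have muB S T : mu (S - T) = mu S - mu T.
  by rewrite /mu -sumrB; apply: eq_bigr => k _; rewrite serD serN mulrBr.
pose Z := foldr (fun c S => (ser_exp (ser_letter R c) - 1) * S) (1 : ser).
(* Multiplying by e^c - 1 gives the difference of the series of two paths in [P], namely [h]
   followed on the right by a letter, and [h] itself. *)
have muZ u h : P h -> mu (path_ser h * Z u) = 0.
  elim: u h => [|c u IH] h Ph; first by rewrite /= mulr1; exact: Pd.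
  rewrite /= mulrA mulrBr mulr1 mulrBl muB IH // subr0.
  by rewrite -path_ser_letter -path_serM IH //; exact: Pc.
have leadZ u : leading u (Z u).
  elim: u => [|c u IH]; first by move=> [].
  by apply: (@leadingM _ [:: c] u) IH; exact: leading_exp_sub1.
(* The path [dR_x] serves as a starting point in [P]: e^A has constant term 1, so multiplying by it
   keeps the leading word. *)
have lead u : leading u (path_ser (dR_x R) * Z u).
  apply: (@leadingM _ [::] u) (leadZ u).
  by rewrite (path_ser_letter false); exact: leading_exp.
(* Descending induction on length: pairing [d] with a series led by [u] isolates [d (wcode u)] once
   the coefficients of longer words vanish. *)
suff H m u : (wcode u < n)%N -> (n - size u <= m)%N -> d (wcode u) = 0.
  by move=> k kn; rewrite -(wordK k); apply: (H n); rewrite ?wordK ?leq_subr.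
elim: m u => [|m IH] u un.
  by have := size_wcode u; lia.
move=> um; have := muZ u _ Px; rewrite /mu (bigD1 (Ordinal un)) //= big1 => [|k ku].
  by rewrite addr0 wcodeK lead // eqxx mulr1.
have [ks|ks] := leqP (size (word k)) (size u).
  rewrite lead //; case: eqP => [e|]; last by rewrite mulr0.
  by case/eqP: ku; apply/val_inj; rewrite /= -e wordK.
by rewrite -{1}(wordK k) (IH (word k)) ?mul0r ?wordK //; lia.
Qed.

(** The paths on which [i] and S agree contain x and are stable under right multiplication by x and
    y. On them the form with coefficients [e k - (k == wcode w)%:R] vanishes, hence it is zero. *)
Lemma dR_embeddingE (i : dR_embedding R) (g : dR_path Tan01 Tan01) :
  i g = path_ser g.
Proof.
apply/funext => w; have [E [L iL]] := dRemb_regular i w.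
(* Large enough both to expand the action on [E] and to include [w]. *)
pose n := (2 ^ cdim E + wcode w)%N.
have dn : (2 ^ cdim E <= n.+1)%N by rewrite /n; lia.
pose e k := \tr (L *m word_act (res0 E) (res1 E) (word k)).
have iE h : i h w = \sum_(k < n.+1) e k * path_ser h (word k).
  rewrite iL (path_expand h dn) mulmx_sumr raddf_sum; apply: eq_bigr => k _ /=.
  by rewrite -scalemxAr linearZ /= mulrC.
have serE (S : ser) : S w = \sum_(k < n.+1) (k == wcode w :> nat)%:R * S (word k).
  have wn : (wcode w < n.+1)%N by rewrite /n; lia.
  rewrite (bigD1 (Ordinal wn)) //= big1 => [|k kw].
    by rewrite eqxx mul1r wcodeK addr0.
  by rewrite -[_ == wcode w]/(k == Ordinal wn) (negbTE kw) mul0r.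
suff d0 k : (k < n.+1)%N -> e k - (k == wcode w)%:R = 0.
  rewrite iE serE; apply: eq_bigr => k _.
  by rewrite (subr0_eq (d0 _ (ltn_ord k))).
apply: (@dR_letter_dense (fun h => i h = path_ser h) n.+1
  (fun k => e k - (k == wcode w)%:R)).
- by rewrite dRemb_x path_ser_x.
- move=> h c hh; rewrite dRemb_mul path_serM hh; congr (_ * _).
  by case: c; rewrite /= (dRemb_x, dRemb_y) (path_ser_x, path_ser_y).
move=> h hh; rewrite (eq_bigr _ (fun _ _ => mulrBl _ _ _)) sumrB -iE -serE hh.
exact: subrr.
Qed.

End WordConnection.

(** * Functions with zero derivative along rays *)

Section ComplexPlane.
Variable R : realType.
Local Notation C := (CC R).
Local Notation cR r := (real_complex R r : C).

Lemma cR_norm (r : R) : `|cR r| = cR `|r|.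
Proof. by rewrite [LHS]normc_def /= expr0n addr0 sqrtr_sqr. Qed.

Lemma pos_cR (e : C) : 0 < e -> exists2 r : R, 0 < r & e = cR r.
Proof.
case: e => a b; rewrite ltcE /= => /andP[/eqP b0 a0].
by exists a; rewrite // b0.
Qed.

Lemma norm_cRE (t : C) : exists2 r : R, 0 <= r & `|t| = cR r.
Proof.
exists (Num.sqrt (complex.Re t ^+ 2 + complex.Im t ^+ 2)); first exact: sqrtr_ge0.
exact: normc_def.
Qed.

Lemma CC_nearP (t : C) (P : C -> Prop) :
  (\forall t' \near t, P t') <->
  exists2 e : R, 0 < e & forall t', `|t - t'| < cR e -> P t'.
Proof.
split=> [/nbhs_ballP[_ /pos_cR[e e0 ->] eP]|[e e0 eP]].
  by exists e => // t' h; exact: eP.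
by apply/nbhs_ballP; exists (cR e); rewrite /= ?ltcR // => t' h; exact: eP.
Qed.

Lemma normc_ge_Im (z : C) : cR `|complex.Im z| <= `|z|.
Proof.
rewrite [`|z|]normc_def lecR -sqrtr_sqr ler_sqrt ?lerDr ?sqr_ge0 //.
by rewrite addr_ge0 ?sqr_ge0.
Qed.

Lemma cvg_cR_mul (t : C) : t != 0 -> cR h * t @[h --> (0 : R)^'] --> (0 : C)^'.
Proof.
move=> t0 P /CC_nearP[e e0 eP]; have [m m0 tm] := norm_cRE t.
have mp : 0 < m.
  rewrite lt_neqAle m0 andbT eq_sym; apply: contraNneq t0 => m00.
  by rewrite -normr_eq0 tm m00.
apply/nbhs_ballP; exists (e / m); first by rewrite /= divr_gt0.
move=> h; rewrite /ball /= sub0r normrN => he h0; apply: eP.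
  by rewrite sub0r normrN normrM tm cR_norm -rmorphM ltcR -ltr_pdivlMr.
by rewrite mulf_neq0 // fmorph_eq0.
Qed.

(** The map [ell] stands for the real or the imaginary part, so that the real mean value theorem
    becomes applicable. *)
Lemma is_derive_ray (ell : C -> R) (u : C -> C) (t : C) (r : R) :
  (forall x y, ell (x - y) = ell x - ell y) ->
  (forall a x, ell (cR a * x) = a * ell x) ->
  (forall x, cR `|ell x| <= `|x|) ->
  is_derive (cR r * t) (1 : C) u 0 ->
  is_derive r (1 : R) (fun s => ell (u (cR s * t))) 0.
Proof.
move=> ellB ellZ ell_le [u_cvg u_lim].
have [->|t0] := eqVneq t 0.
  under eq_fun do rewrite mulr0; exact: is_derive_cst.
have [m m0 tm] := norm_cRE t.
have u0 : (fun h : C => h^-1 *: (u (h *: 1 + cR r * t) - u (cR r * t))) @ 0^' --> (0 : C).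
  by rewrite -[X in _ --> X]u_lim; exact: u_cvg.
have {u_cvg u_lim} u0 := cvg_comp _ _ (cvg_cR_mul t0) u0.
suff H : (fun h : R => h^-1 *: (ell (u (cR (h *: 1 + r) * t)) - ell (u (cR r * t)))) @ 0^'
    --> (0 : R).
  by split; [apply: cvgP H|apply: cvg_lim H].
apply/cvgr0Pnorm_le => e e0.
(* The chain rule multiplies the bound by [m], the modulus of [t], and [m * (e / (m + 1))] is at
   most [e]. *)
have em0 : 0 < e / (m + 1) by rewrite divr_gt0 // ltr_wpDl.
have := cvgr0_norm_le _ u0 (cR (e / (m + 1))); rewrite ltcR => /(_ _ em0).
apply: filterS => h /= hle; rewrite -ellB.
have [->|h0] := eqVneq h 0; first by rewrite invr0 scale0r normr0 ltW.
rewrite -[_ *: _]/(_ * _) -ellZ -lecR (le_trans (ell_le _)) //.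
move: hle; rewrite -![_ *: _]/(_ * _) mulr1 -mulrDl -rmorphD /=.
rewrite (_ : h * 1 = h) ?mulr1 //.
set du := u _ - u _ => hle.
have -> : cR h^-1 * du = t * ((cR h * t)^-1 * du).
  by rewrite fmorphV invfM [_^-1 * t^-1]mulrC -!mulrA mulVKf.
rewrite normrM tm (le_trans (ler_wpM2l _ hle)) ?ler0c // -rmorphM lecR.
by rewrite mulrA ler_pdivrMr ?ltr_wpDl // mulrC ler_pM2l // lerDl.
Qed.

Lemma ray_constant (u : C -> C) (t : C) (a : R) : a <= 1 ->
  (forall r, a <= r <= 1 -> is_derive (cR r * t) (1 : C) u 0) ->
  u (cR a * t) = u t.
Proof.
move=> a1 du; suff H (ell : C -> R) :
    (forall x y, ell (x - y) = ell x - ell y) ->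
    (forall a x, ell (cR a * x) = a * ell x) ->
    (forall x, cR `|ell x| <= `|x|) ->
    ell (u (cR a * t)) = ell (u t).
  have reE := H (@complex.Re R); have imE := H (@complex.Im R).
  apply/eqP; rewrite eq_complex reE ?imE ?eqxx //.
  - by case=> ? ? [].
  - by move=> b [x y] /=; rewrite mul0r addr0.
  - exact: normc_ge_Im.
  - by case=> ? ? [].
  - by move=> b [x y] /=; rewrite mul0r subr0.
  - exact: normc_ge_Re.
move=> ellB ellZ ell_le.
have dr r : a <= r <= 1 -> is_derive r (1 : R) (fun s => ell (u (cR s * t))) 0.
  by move=> /du; exact: is_derive_ray.
have [||c _] := @MVT_segment R (fun s => ell (u (cR s * t))) (fun=> 0) a 1 a1.
- by move=> r; rewrite in_itv /= => /andP[ar r1]; apply: dr; rewrite !ltW.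
- by apply: derivable_within_continuous => r; rewrite in_itv /= => /dr; case.
by rewrite /= mul0r rmorph1 mul1r => /eqP; rewrite subr_eq0 => /eqP.
Qed.

End ComplexPlane.

(** * Growth of powers of the logarithm at 0 *)

Lemma pow_ln_small (R : realType) (k : R) n (e : R) : 0 < e ->
  \forall r \near (0 : R)^'+, r * (k - ln r) ^+ n <= e.
Proof.
move=> e0; pose M := expR k * n.+1`!%:R / e.
have f0 : 0 < n.+1`!%:R :> R by rewrite ltr0n fact_gt0.
have M0 : 0 < M by rewrite divr_gt0 // mulr_gt0 ?expR_gt0.
near=> r; have r0 : 0 < r by near: r; exact: nbhs_right_gt.
have rM : r < expR (k - M) by near: r; apply: nbhs_right_lt; exact: expR_gt0.
set s := k - ln r.
have sM : M < s by rewrite /s ltrBrDl -ltrBrDr -ltr_expR lnK.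
have s0 : 0 < s := lt_trans M0 sM.
rewrite -(ler_pM2r s0) -mulrA -exprSr.
have -> : r = expR k / expR s by rewrite -expRN -expRD /s opprB addrC subrK lnK.
apply: (@le_trans _ _ (e * M)); last by rewrite ler_pM2l // ltW.
rewrite /M mulrCA divff ?gt_eqF // mulr1 mulrAC ler_pdivrMr ?expR_gt0 // -mulrA.
rewrite ler_pM2l ?expR_gt0 // mulrC -ler_pdivrMr //.
by apply: le_trans (expR_ge1Dxn n (ltW s0)); rewrite lerDr ler01.
Unshelve. all: by end_near. Qed.

Section Growth.
Variable R : realType.
Local Notation C := (CC R).
Local Notation cR r := (real_complex R r : C).

(** Scaling by a positive real preserves [Re / |.|] and the sign of the imaginary part, hence [Arg],
    even on the cut. *)
Lemma Log_ray (t : C) (r : R) : t != 0 -> 0 < r ->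
  Log (cR r * t) = Log t + cR (ln r).
Proof.
move=> t0 r0; have [m m0 tm] := norm_cRE t.
have mp : 0 < m.
  rewrite lt_neqAle m0 andbT eq_sym; apply: contraNneq t0 => m00.
  by rewrite -normr_eq0 tm m00.
have rt : `|cR r * t| = cR (r * m) by rewrite normrM tm cR_norm gtr0_norm // -rmorphM.
rewrite /Log /Arg rt tm; case: t {t0 tm rt} => x y.
have -> : cR r * Complex x y = Complex (r * x) (r * y).
  by rewrite /GRing.mul /= !mul0r subr0 addr0.
apply/eqP; rewrite eq_complex /=; apply/andP; split.
  by rewrite lnM ?posrE // addrC.
by rewrite addr0 pmulr_rge0 // -mulf_div divff ?lt0r_neq0 // mul1r.
Qed.

Lemma pow_Log_cvg0 (t : C) n : t != 0 ->
  cR r * Log (cR r * t) ^+ n @[r --> (0 : R)^'+] --> (0 : C).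
Proof.
move=> t0; apply/cvgr0Pnorm_le => _ /pos_cR[e e0 ->].
have [k k0 Lk] := norm_cRE (Log t); near=> r.
have r0 : 0 < r by near: r; exact: nbhs_right_gt.
have r1 : r < 1 by near: r; apply: nbhs_right_lt; exact: ltr01.
rewrite Log_ray // normrM normrX cR_norm (gtr0_norm r0).
apply: (@le_trans _ _ (cR (r * (k - ln r) ^+ n))).
  rewrite rmorphM /= ler_wpM2l ?ler0c ?(ltW r0) // rmorphXn /= lerXn2r ?nnegrE //.
    by rewrite ler0c subr_ge0 (le_trans _ k0) // ln_le0 // ltW.
  rewrite (le_trans (ler_normD _ _)) // Lk cR_norm -rmorphD lecR lerD2l.
  by rewrite ler0_norm // ln_le0 // ltW.
by rewrite lecR; near: r; exact: pow_ln_small.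
Unshelve. all: by end_near. Qed.

(** Write Q(rt) as its difference quotient at 0 times rt: the quotient converges, and the factor r
    absorbs the power of the logarithm. *)
Lemma holomorphic_pow_Log_cvg0 (Q : C -> C) (t : C) n : t != 0 ->
  holomorphic_at Q 0 -> Q 0 = 0 ->
  Q (cR r * t) * Log (cR r * t) ^+ n @[r --> (0 : R)^'+] --> (0 : C).
Proof.
move=> t0 /cvg_ex[l Ql] Q0.
have right_sub : (0 : R)^'+ `=>` (0 : R)^'.
  move=> P; rewrite /dnbhs /at_right /within /=; apply: filterS => r Pr r0.
  by apply: Pr; rewrite gt_eqF.
have ct : cR h * t @[h --> (0 : R)^'+] --> (0 : C)^'.
  by move=> P /(cvg_cR_mul t0)/right_sub.
have Qt := cvg_comp _ _ ct Ql.
have := cvgM (cvgM Qt (cvg_cst t)) (pow_Log_cvg0 n t0).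
rewrite mulr0 => /(_ _ _ _) H; apply: (cvg_trans _ H) => {H}; apply: near_eq_cvg; near=> r.
have r0 : 0 < r by near: r; exact: nbhs_right_gt.
rewrite /= Q0 subr0 addr0 -[_%:A]/(_ * 1) mulr1 -[_ *: _]/(_ * _).
set q := Q _; set L := Log _ ^+ n; set c := cR r.
have c0 : c != 0 by rewrite /c fmorph_eq0 gt_eqF.
by field; apply/andP.
Unshelve. all: by end_near. Qed.

Lemma holomorphic_exp_Log_cvg0 (Q : C -> C) (t : C) w : t != 0 ->
  holomorphic_at Q 0 -> Q 0 = 0 ->
  Q (cR r * t) * ser_exp (Log (cR r * t) *: serA) w @[r --> (0 : R)^'+] --> (0 : C).
Proof.
move=> t0 Qh Q0; pose N := (size w).+1.
pose F j (r : R) := (j`!%:R^-1 * (ser_letter R false ^+ j) w) *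
  (Q (cR r * t) * Log (cR r * t) ^+ j).
have -> : (fun r => Q (cR r * t) * ser_exp (Log (cR r * t) *: serA) w) =
    (fun r => \sum_(j < N) F j r).
  apply/funext => r; rewrite (@ser_expE _ _ false w N) // mulr_sumr.
  by apply: eq_bigr => j _; rewrite /F; ring.
suff: \sum_(j < N) F j r @[r --> (0 : R)^'+] --> \sum_(j < N) (0 : C) by rewrite big1_eq.
apply: cvg_big => [|j _]; first exact: add_continuous.
rewrite /F -[X in _ --> X](mulr0 (j`!%:R^-1 * (ser_letter R false ^+ j) w)).
by apply: cvgM; [exact: cvg_cst|exact: holomorphic_pow_Log_cvg0].
Qed.
End Growth.

(** * Horizontal sections and the KZ solution near 0 *)

Section Uniqueness.
Variable R : realType.
Local Notation C := (CC R).
Local Notation cR r := (real_complex R r : C).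

Lemma ray_eq0 (u : C -> C) (t : C) :
  (forall r, 0 < r <= 1 -> is_derive (cR r * t) (1 : C) u 0) ->
  u (cR r * t) @[r --> (0 : R)^'+] --> (0 : C) -> u t = 0.
Proof.
move=> du u0; suff : (fun=> u t) @ (0 : R)^'+ --> (0 : C).
  by move=> /cvg_lim <- //; rewrite lim_cst.
apply: cvg_trans u0; apply: near_eq_cvg; near=> r.
have r0 : 0 < r by near: r; exact: nbhs_right_gt.
apply: ray_constant => [|s /andP[rs s1]].
  by near: r; apply: nbhs_right_le; exact: ltr01.
by apply: du; rewrite s1 (lt_le_trans r0 rs).
Unshelve. all: by end_near. Qed.

(** Row [k] only involves a column [j] with [j.*2.+1 + c = k], so [j < k]; this triangularity drives
    the induction in [horizontal_KZ]. *)
Lemma lmx_agree n c (v : 'cV[C]_n) (S : ncseries R) (k : 'I_n) :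
  (forall j : 'I_n, (j < k)%N -> v j 0 = S (word j)) ->
  (lmx R n c *m v) k 0 = (ser_letter R c * S) (word k).
Proof.
move=> vS; transitivity ((lmx R n c *m ser_col n S) k 0); last by rewrite lmx_col mxE.
rewrite !mxE; apply: eq_bigr => j _; rewrite !mxE.
case: eqP => [e|]; last by rewrite !mul0r.
by rewrite vS //; lia.
Qed.

Lemma horizontal_KZ n (f : C -> 'cV[C]_n.+1) (G : C -> ncseries R) :
  @tangential_section R (word_conn R n) (ser_col n.+1 1) f -> KZ_fundamental G ->
  \forall t \near (0 : C), 0 < complex.Re t ->
    forall k : 'I_n.+1, f t k 0 = G t (word k).
Proof.
move=> [hor [P [Ph P0 fP]]] [dG [P' [P'h P'0 GP]]].
(* For [G] the neighbourhood depends on the word; only the finitely many words of code at most [n]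
   matter here. *)
have {}GP : \forall t \near (0 : C), forall k : 'I_n.+1, slit t ->
    G t (word k) = (P' t * ser_exp (Log t *: serA)) (word k).
  exact: (@filter_forall _ _ _ (nbhs (0 : C)) _ (fun k : 'I_n.+1 => GP (word k))).
have lt1 := @nbhs0_lt C C 1 ltr01.
have /CC_nearP[d d0 dP] : \forall t \near (0 : C),
    [/\ slit t -> @horizontal_at R (word_conn R n) f t, `|t| < 1,
        slit t -> f t = P t *m nilexp (- Log t *: - lmx R n.+1 false) *m ser_col n.+1 1
      & forall k : 'I_n.+1, slit t ->
        G t (word k) = (P' t * ser_exp (Log t *: serA)) (word k)].
  by near=> t; split; near: t.
(* This half-disc avoids the cuts of both solutions and is stable under contraction along rays
   towards 0. *)
pose half t := (`|0 - t| < cR d) && (0 < complex.Re t).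
have halfP t : half t -> [/\ @horizontal_at R (word_conn R n) f t, bislit t,
    f t = P t *m ser_col n.+1 (ser_exp (Log t *: serA))
  & forall k : 'I_n.+1, G t (word k) = (P' t * ser_exp (Log t *: serA)) (word k)].
  move=> /andP[/dP[h t1 fE GE] t0]; have sl : slit t by rewrite /slit t0.
  split; [exact: h| | |by move=> k; exact: GE].
    rewrite /bislit t0 /=; apply/orP; left.
    have := le_lt_trans (normc_ge_Re t) t1.
    by rewrite -[1 in X in _ < X]/(cR 1) ltcR ltr_norml => /andP[].
  by rewrite fE // scalerN scaleNr opprK -mulmxA (nilexp_lmx _ false).
have half_ray t r : half t -> 0 < r <= 1 -> half (cR r * t).
  move=> /andP[]; rewrite !sub0r !normrN => td t0 /andP[r0 r1]; apply/andP; split.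
    rewrite sub0r normrN normrM cR_norm (gtr0_norm r0).
    by apply: le_lt_trans td; rewrite ler_piMl // -[1]/(cR 1) lecR.
  by case: t t0 {td} => x y /= t0; rewrite mul0r subr0 mulr_gt0.
suff H m (k : 'I_n.+1) t : (k < m)%N -> half t -> f t k 0 = G t (word k).
  by apply/CC_nearP; exists d => // t td t0 k; apply: (H k.+1) => //; rewrite /half td.
elim: m k t => // m IH k t km ht; apply/eqP; rewrite -subr_eq0; apply/eqP.
apply: (@ray_eq0 (fun s => f s k 0 - G s (word k))) => [r r01|].
  have hs := half_ray _ _ ht r01; set s := cR r * t in hs *.
  have [/(_ k) fs sl _ _] := halfP _ hs; have Gs := dG _ sl (word k).
  have := is_deriveB fs Gs.
  suff -> : (- (s^-1 *: res0 (word_conn R n) + (s - 1)^-1 *: res1 (word_conn R n)) *m f s)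
       k 0 = ((s^-1 *: serA + (s - 1)^-1 *: serB) * G s) (word k).
    by rewrite subrr.
  have agree (j : 'I_n.+1) : (j < k)%N -> f s j 0 = G s (word j).
    by move=> jk; apply: IH hs; lia.
  have -> : (- (s^-1 *: res0 (word_conn R n) + (s - 1)^-1 *: res1 (word_conn R n)) *m f s)
      k 0 = s^-1 * (lmx R n.+1 false *m f s) k 0 +
            (s - 1)^-1 * (lmx R n.+1 true *m f s) k 0.
    rewrite /= !scalerN -opprD opprK mulmxDl -!scalemxAl [LHS]mxE.
    by congr (_ + _); rewrite mxE.
  by rewrite (lmx_agree false agree) (lmx_agree true agree) mulrDl !ser_scaleAl.
have t0 : t != 0.
  by case/andP: ht => _; apply: contraTneq => ->; rewrite ltxx.
pose X r : ncseries R := ser_exp (Log (cR r * t) *: serA).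
pose w := word k.
(* [D] and [D'] are the coefficients of (P - 1)X and (P' - 1)X. The common term X cancels in
   [D r - D' r], which is the difference of the two solutions. *)
pose D r := \sum_(j < n.+1) (P (cR r * t) k j - (k == j)%:R) * X r (word j).
pose D' r := \sum_(l < (size w).+1)
  (P' (cR r * t) (take l w) - (1 : ncseries R) (take l w)) * X r (drop l w).
have limD : D r @[r --> (0 : R)^'+] --> (0 : C).
  suff : D r @[r --> (0 : R)^'+] --> \sum_(j < n.+1) (0 : C) by rewrite big1_eq.
  apply: cvg_big => [|j _]; first exact: add_continuous.
  apply: (@holomorphic_exp_Log_cvg0 R (fun s => P s k j - (k == j)%:R) t _ t0).
    by apply: derivableB; [exact: (nbhs_singleton Ph)|exact: derivable_cst].
  by rewrite P0 mxE subrr.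
have limD' : D' r @[r --> (0 : R)^'+] --> (0 : C).
  suff : D' r @[r --> (0 : R)^'+] --> \sum_(l < (size w).+1) (0 : C).
    by rewrite big1_eq.
  apply: cvg_big => [|l _]; first exact: add_continuous.
  apply: (@holomorphic_exp_Log_cvg0 R
    (fun s => P' s (take l w) - (1 : ncseries R) (take l w)) t (drop l w) t0).
    by apply: derivableB; [exact: (nbhs_singleton (P'h _))|exact: derivable_cst].
  by rewrite P'0 subrr.
have := cvgB limD limD'; rewrite subrr => /(_ _ _) H; apply: (cvg_trans _ H) => {H}.
apply: near_eq_cvg; near=> r; have r01 : 0 < r <= 1.
  apply/andP; split; first by near: r; exact: nbhs_right_gt.
  by near: r; apply: nbhs_right_le; exact: ltr01.
have [_ _ -> ->] := halfP _ (half_ray _ _ ht r01).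
rewrite -/(X r) -/w -[LHS]/(D r - D' r).
have -> : D r = (P (cR r * t) *m ser_col n.+1 (X r)) k 0 - X r w.
  transitivity (((P (cR r * t) - 1%:M) *m ser_col n.+1 (X r)) k 0).
    by rewrite mxE; apply: eq_bigr => j _; rewrite !mxE.
  by rewrite mulmxBl mul1mx mxE; congr (_ + _); rewrite !mxE.
have -> : D' r = (P' (cR r * t) * X r) w - X r w.
  by rewrite -[X r in X in _ - X]mul1r -serN -serD -mulrBl.
by rewrite opprB addrA subrK.
Unshelve. all: by end_near. Qed.

End Uniqueness.

(** * Continuation along the path *)

Local Notation cR r := (real_complex _ r : CC _).

Theorem proposition2p20 (R : realType) (z : punctured R) (b : R -> CC R)
    (hb : tangential_path b z)
    (bz : dR_path (@Tan01 R) (Pt z)) (hbz : hodge_comparison b bz)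
    (i : dR_embedding R)
    (G0 : CC R -> ncseries R) (hG0 : KZ_fundamental G0) :
  exists2 G0z : ncseries R,
    continued_value b G0 G0z & i (dR_comp (dR_inv (dR_dz z)) bz) = G0z.
Proof.
exists (i (dR_comp (dR_inv (dR_dz z)) bz)) => // w.
have -> : i (dR_comp (dR_inv (dR_dz z)) bz) w = path_ser bz w.
  by rewrite dR_embeddingE /path_ser /= invmx1 mul1mx.
(* In [word_conn n] the word [w] is the last basis vector; the section starting at the empty word
   has S(b_z)_w as its last coordinate at the end of [b]. *)
pose n := wcode w; pose k : 'I_n.+1 := ord_max.
have [f tf [F [Fh Floc Ff F1]]] := hbz (word_conn R n) (ser_col n.+1 1).
exists (fun s t => F s t k 0); split.
- move=> s s01; apply: filterS (Fh s s01) => t /(_ k)[]; by [].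
- move=> s s01; apply: filterS (Floc s s01) => s' ss' /ss'.
  by apply: filterS => t ->.
- have /CC_nearP[d d0 dP] := horizontal_KZ tf hG0.
  have [_ _ bs _ _] := hb.
  have half0 : 0 < 2^-1 :> CC R by rewrite invr_gt0 ltr0n.
  have /cvgrPdist_le /(_ _ half0) bs2 := bs.
  near=> s.
  have s0 : 0 < s by near: s; exact: nbhs_right_gt.
  have sd : s < d / 2 by near: s; apply: nbhs_right_lt; rewrite divr_gt0.
  have bss : `|1 - b s / (s%:C)%C| <= 2^-1 by near: s.
  have nearb : \forall t \near b s, F s t = f t by near: s.
  (* Velocity 1 at 0 places [b s] within [s / 2] of [s]. The disc of radius [s / 2] around [b s]
     then lies in the open disc of radius [s] around [s], inside the right half-plane and within
     [2 s < d] of 0. *)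
  have bs' : `|cR s - b s| <= cR (s / 2).
    have sN0 : cR s != 0 by rewrite fmorph_eq0 gt_eqF.
    have -> : cR s - b s = cR s * (1 - b s / cR s) by field.
    rewrite normrM cR_norm (gtr0_norm s0) rmorphM fmorphV rmorph_nat.
    by rewrite ler_wpM2l // ler0c ltW.
  have /CC_nearP[e e0 eP] := nearb.
  apply/CC_nearP; exists (Num.min e (s / 2)) => [|t].
    by rewrite lt_min e0 divr_gt0.
  move=> tm; have te : `|b s - t| < cR e.
    by apply: lt_le_trans tm _; rewrite lecR ge_min lexx.
  have ts : `|b s - t| < cR (s / 2).
    by apply: lt_le_trans tm _; rewrite lecR ge_min lexx orbT.
  have st : `|cR s - t| < cR s.
    rewrite -[cR s - t](subrKA (b s)) (le_lt_trans (ler_normD _ _)) //.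
    by rewrite [X in _ < cR X]splitr rmorphD ler_ltD.
  rewrite eP // (dP t _ _ k) ?wcodeK //.
    rewrite sub0r normrN -[t](subKr (cR s)) (le_lt_trans (ler_normB _ _)) //.
    rewrite cR_norm (gtr0_norm s0); apply: (@lt_le_trans _ _ (cR (s + s))).
      by rewrite rmorphD /= ltrD2l.
    by rewrite lecR; lra.
  have := le_lt_trans (normc_ge_Re _) st.
  rewrite ltcR; case: (t) => x y /=; rewrite ltr_norml => /andP[_]; lra.
by rewrite F1 mul_ser_col1 mxE.
Unshelve. all: by end_near. Qed.
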